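(* Let $X$ be an infinite dimensional Banach lattice. Then $X_L$ is a rearrangement invariant Banach sequence space and $X_U$ is a Banach sequence lattice. Moreover, if $\ell_\infty$ is not finitely lattice representable in $X$, then $X_U$ is also a rearrangement invariant Banach sequence space.
   Context: All Banach lattices are real. For a Banach lattice $X$ and $n\in\mathbb N$, $\mathfrak B_n(X)$ is the set of $n$-tuples $(x_1,\dots,x_n)$ of pairwise disjoint ($|x_i|\wedge|x_j|=0$, $i\ne j$) elements of norm $1$. For $a\in\mathbb R^n$: $\|a\|_{X_U(n)}:=\sup\{\|\sum_{i=1}^n a_ix_i\|_X:(x_i)\in\mathfrak B_n(X)\}$; $\Phi_n(a):=\inf\{\|\sum_{i=1}^n a_ix_i\|_X:(x_i)\in\mathfrak B_n(X)\}$; $\|a\|_{X_L(n)}:=\inf\{\sum_{k\in F}\Phi_n(a^k): F\text{ finite}, a^k\in\mathbb R^n, a=\sum_{k\in F}a^k\}$. $X_U$ (resp. $X_L$) is the space of real sequences $a$ with $\|a\|_{X_U}:=\sup_n\|(a_i)_{i=1}^n\|_{X_U(n)}<\infty$ (resp. $\|a\|_{X_L}:=\sup_n\|(a_i)_{i=1}^n\|_{X_L(n)}<\infty$). A Banach sequence lattice is a complete normed space $E$ of real sequences such that $a\in E$, $|b_i|\le|a_i|$ for all $i$ imply $b\in E$, $\|b\|_E\le\|a\|_E$. It is rearrangement invariant if $a\in E$ and $\#\{i:|b_i|>t\}\le\#\{i:|a_i|>t\}$ for all $t>0$ imply $b\in E$ and $\|b\|_E\le\|a\|_E$. $\ell_p$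 ($1\le p\le\infty$) is finitely lattice representable in $X$ if for every $n$ and $\varepsilon>0$ there exist pairwise disjoint $x_1,\dots,x_n\in X$ with $\|a\|_{\ell_p^n}\le\|\sum a_ix_i\|_X\le(1+\varepsilon)\|a\|_{\ell_p^n}$ for all $a\in\mathbb R^n$. *)

(* Defs.v *)
From HB Require Import structures.
From mathcomp Require Import all_boot all_order all_algebra.
From mathcomp Require Import all_classical all_reals all_analysis.
Set Implicit Arguments. Unset Strict Implicit. Unset Printing Implicit Defensive.
Import Order.TTheory GRing.Theory Num.Theory.
Import numFieldNormedType.Exports.
Local Open Scope classical_set_scope.
Local Open Scope ring_scope.

Section BanachLattice.
Variables (R : realType) (V : completeNormedModType R).
Variables (le : V -> V -> Prop) (join : V -> V -> V).

Definition vmeet (x y : V) : V := - join (- x) (- y).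
Definition vabs (x : V) : V := join x (- x).

Record is_banach_lattice : Prop := {
  bl_refl : forall x, le x x;
  bl_trans : forall x y z, le x y -> le y z -> le x z;
  bl_antisym : forall x y, le x y -> le y x -> x = y;
  bl_add : forall x y z, le x y -> le (x + z) (y + z);
  bl_scale : forall (a : R) x y, 0 <= a -> le x y -> le (a *: x) (a *: y);
  bl_join_l : forall x y, le x (join x y);
  bl_join_r : forall x y, le y (join x y);
  bl_join_least : forall x y z, le x z -> le y z -> le (join x y) z;
  bl_norm : forall x y, le (vabs x) (vabs y) -> `|x| <= `|y|
}.

Definition vdisjoint (x y : V) : Prop := vmeet (vabs x) (vabs y) = 0.

Definition frakB (n : nat) : set (nat -> V) :=
  [set x | (forall i, (i < n)%N -> `|x i| = 1) /\
           (forall i j, (i < n)%N -> (j < n)%N -> i != j -> vdisjoint (x i) (x j))].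

Definition combo (n : nat) (a : nat -> R) (x : nat -> V) : V :=
  \sum_(i < n) a i *: x i.

Definition normXUn (n : nat) (a : nat -> R) : \bar R :=
  ereal_sup [set (`|combo n a x|)%:E | x in frakB n].

Definition Phi (n : nat) (a : nat -> R) : \bar R :=
  ereal_inf [set (`|combo n a x|)%:E | x in frakB n].

Definition normXLn (n : nat) (a : nat -> R) : \bar R :=
  ereal_inf [set (\sum_(b <- s) Phi n b)%E | s in
     [set s : seq (nat -> R) | forall i, (i < n)%N -> a i = \sum_(b <- s) b i]].

Definition normXU (a : nat -> R) : \bar R := ereal_sup (range (fun n => normXUn n a)).
Definition normXL (a : nat -> R) : \bar R := ereal_sup (range (fun n => normXLn n a)).

Definition XU : set (nat -> R) := [set a | (normXU a < +oo)%E].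
Definition XL : set (nat -> R) := [set a | (normXL a < +oo)%E].
Definition nXU (a : nat -> R) : R := fine (normXU a).
Definition nXL (a : nat -> R) : R := fine (normXL a).

Definition infinite_dimensional : Prop :=
  forall n : nat, exists v : 'I_n -> V,
    forall c : 'I_n -> R, \sum_(i < n) c i *: v i = 0 -> forall i, c i = 0.

Definition linf_flr : Prop :=
  forall (n : nat) (eps : R), 0 < eps ->
    exists x : nat -> V,
      (forall i j, (i < n)%N -> (j < n)%N -> i != j -> vdisjoint (x i) (x j)) /\
      forall a : nat -> R,
        let m := \big[Num.max/0]_(i < n) `|a i| in
        m <= `|combo n a x| /\ `|combo n a x| <= (1 + eps) * m.

End BanachLattice.

Section SeqLattice.
Variable R : realType.
Local Open Scope classical_set_scope.

Record banach_seq_lattice (E : set (nat -> R)) (nrm : (nat -> R) -> R) : Prop := {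
  bsl_zero : E (fun _ => 0);
  bsl_add : forall a b, E a -> E b -> E (fun i => a i + b i);
  bsl_scale : forall (c : R) a, E a -> E (fun i => c * a i);
  bsl_norm_ge0 : forall a, E a -> 0 <= nrm a;
  bsl_norm_eq0 : forall a, E a -> nrm a = 0 -> a = (fun _ => 0);
  bsl_norm_hom : forall (c : R) a, E a -> nrm (fun i => c * a i) = `|c| * nrm a;
  bsl_norm_tri : forall a b, E a -> E b -> nrm (fun i => a i + b i) <= nrm a + nrm b;
  bsl_complete : forall u : nat -> nat -> R, (forall k, E (u k)) ->
      (forall eps : R, 0 < eps -> exists N, forall m n, (N <= m)%N -> (N <= n)%N ->
          nrm (fun i => u m i - u n i) <= eps) ->
      exists a, E a /\ (forall eps : R, 0 < eps -> exists N, forall n, (N <= n)%N ->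
          nrm (fun i => u n i - a i) <= eps);
  bsl_solid : forall a b, E a -> (forall i, `|b i| <= `|a i|) -> E b /\ nrm b <= nrm a
}.

Definition rearrangement_invariant (E : set (nat -> R)) (nrm : (nat -> R) -> R) : Prop :=
  forall a b, E a ->
    (forall t : R, 0 < t -> ([set i | t < `|b i|] #<= [set i | t < `|a i|])%card) ->
    E b /\ nrm b <= nrm a.

Definition ri_banach_seq_space E nrm : Prop :=
  banach_seq_lattice E nrm /\ rearrangement_invariant E nrm.
End SeqLattice.

(* Main.v *)
Require Import Defs.
From HB Require Import structures.
From mathcomp Require Import all_boot all_order all_algebra.
From mathcomp Require Import all_classical all_reals all_analysis.
From mathcomp Require Import lra.
Set Implicit Arguments. Unset Strict Implicit. Unset Printing Implicit Defensive.
Import Order.TTheory GRing.Theory Num.Theory.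
Import numFieldNormedType.Exports.
Local Open Scope classical_set_scope.
Local Open Scope ring_scope.

(** Both [normXL] and [normXU] are suprema over [n] of solid norms on [R^n] lying between
    the sup norm and the [l_1] norm, and any such supremum defines a Banach sequence
    lattice.  It is rearrangement invariant as soon as the [n]-th norm of [a \o t] is at
    most the [M]-th norm of [a] for every injection [t] of [n] indices into [M].

    For [X_L] this holds because dropping terms of a disjoint sum decreases its norm.  For
    [X_U] one has to enlarge a disjoint normalized [n]-tuple [x] to an [M]-tuple, almost
    without changing its norm.  Take many disjoint groups of [M] disjoint unit vectors
    [y_(s, k)], with group sums [Y_s].  If every [(sum |x_i|) /\ lam Y_s] were large, these
    disjoint elements would have a bounded sum, and a blocking argument of James would make
    [l_oo] finitely lattice representable.  So for some [s] the elements
    [(|x_i| - lam Y_s)^+] are close to [|x_i|], and they are disjoint from the nonzero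
    elements [(lam y_(s, k) - sum |x_i|)^+]. *)

(** * Sequence lattices from suprema of solid norms on R^n *)

Section SolidNorms.
Context (R : realType).

Definition inj_into (n M : nat) (t : nat -> nat) :=
  (forall i, (i < n)%N -> (t i < M)%N) /\
  {in [pred i | (i < n)%N] &, injective t}.

(** Definiteness of the supremum comes from [sn_ge]; [sn_scale] asks for nonzero c because [sn_l1]
    settles c = 0. *)
Record solid_norms (p : nat -> (nat -> R) -> R) : Prop := {
  sn_ge0 : forall n a, 0 <= p n a;
  sn_ge : forall n a i, (i < n)%N -> `|a i| <= p n a;
  sn_l1 : forall n a, p n a <= \sum_(i < n) `|a i|;
  sn_add : forall n a b, p n (fun i => a i + b i) <= p n a + p n b;
  sn_scale : forall n c a, c != 0 -> p n (fun i => c * a i) <= `|c| * p n a;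
  sn_solid : forall n a b, (forall i, (i < n)%N -> `|b i| <= `|a i|) -> p n b <= p n a
}.

Definition sup_norm (p : nat -> (nat -> R) -> R) (a : nat -> R) : \bar R :=
  ereal_sup (range (fun n => (p n a)%:E)).

Variable p : nat -> (nat -> R) -> R.
Hypothesis hp : solid_norms p.

Let E : set (nat -> R) := [set a | (sup_norm p a < +oo)%E].
Let nrm (a : nat -> R) : R := fine (sup_norm p a).

Lemma sup_norm_ge0 a : (0 <= sup_norm p a)%E.
Proof.
apply: le_ereal_sup_tmp; exists (p 0 a)%:E; first by exists 0%N.
by rewrite lee_fin (sn_ge0 hp).
Qed.

(** Since [fine] sends +oo to 0, a bound on [nrm a] says something only together with membership in
    [E]; one bound K, uniform in n, yields both. *)
Lemma sup_norm_bound a (K : R) : (forall n, p n a <= K) -> E a /\ nrm a <= K.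
Proof.
move=> h; have aK : (sup_norm p a <= K%:E)%E.
  by apply: ge_ereal_sup => _ [n _ <-]; rewrite lee_fin.
have Ea : E a by apply: le_lt_trans aK (ltry _).
split=> //; rewrite -lee_fin fineK// ge0_fin_numE//; exact: sup_norm_ge0.
Qed.

Lemma le_sup_norm a n : E a -> p n a <= nrm a.
Proof.
move=> Ea; rewrite -lee_fin fineK; last by rewrite ge0_fin_numE//; exact: sup_norm_ge0.
by apply: ereal_sup_ubound; exists n.
Qed.

Lemma solid_norms_opp n a : p n (fun i => - a i) <= p n a.
Proof. by apply: (sn_solid hp) => i _; rewrite normrN. Qed.

Lemma solid_norms_sub n a b : p n (fun i => a i - b i) <= p n a + p n b.
Proof.
apply: le_trans (sn_add hp n a (fun i => - b i)) _.
by rewrite lerD2l solid_norms_opp.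
Qed.

Lemma solid_norms_scale n c a : p n (fun i => c * a i) <= `|c| * p n a.
Proof.
have [->|c0] := eqVneq c 0; last exact: (sn_scale hp).
rewrite normr0 mul0r; apply: le_trans (sn_l1 hp _ _) _.
by rewrite big1 // => i _; rewrite mul0r normr0.
Qed.

(** By [sn_ge] the coordinates converge. For fixed n, [sn_l1] turns this into convergence in [p n],
    and the Cauchy bound, uniform in n, passes to the limit. *)
Lemma sup_norm_complete (u : nat -> nat -> R) : (forall k, E (u k)) ->
  (forall eps : R, 0 < eps -> exists N, forall m n, (N <= m)%N -> (N <= n)%N ->
     nrm (fun i => u m i - u n i) <= eps) ->
  exists a, E a /\ (forall eps : R, 0 < eps -> exists N, forall n, (N <= n)%N ->
     nrm (fun i => u n i - a i) <= eps).
Proof.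
move=> Eu cu.
have Esub m n : E (fun i => u m i - u n i).
  apply: (sup_norm_bound (K := nrm (u m) + nrm (u n)) _).1 => k.
  by apply: le_trans (solid_norms_sub _ _ _) _; apply: lerD; apply: le_sup_norm.
have cvgu i : cvg (u^~ i @ \oo).
  apply/cauchy_cvgP/cauchy_exP => e e0.
  have [N hN] := cu (e / 2) (divr_gt0 e0 (ltr0Sn _ _)).
  exists (u N i); exists N => // k /= Nk; rewrite /ball /=.
  apply: le_lt_trans (sn_ge hp (fun i => u N i - u k i) (ltnSn i)) _.
  apply: le_lt_trans (le_sup_norm _ (Esub N k)) _.
  by apply: le_lt_trans (hN _ _ (leqnn N) Nk) _; rewrite ltr_pdivrMr// ltr_pMr// ltr1n.
pose a i := lim (u^~ i @ \oo).
have ua i e : 0 < e -> exists N, forall k, (N <= k)%N -> `|u k i - a i| <= e.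
  move=> e0; have /cvgrPdist_le/(_ e e0)[N _ hN] := cvgu i.
  by exists N => k Nk; rewrite distrC; apply: hN.
have small n e N : 0 < e -> exists2 k, (N <= k)%N & p n (fun i => u k i - a i) <= e.
  move=> e0; have d0 : 0 < e / n.+1%:R by rewrite divr_gt0.
  have [K hK] := choice (fun i => ua i _ d0).
  (* This index is at least N and at least every [K i] with i < n. *)
  exists (N + \sum_(i < n) K i)%N; first exact: leq_addr.
  apply: le_trans (sn_l1 hp _ _) _.
  apply: (@le_trans _ _ (\sum_(i < n) e / n.+1%:R)).
    apply: ler_sum => i _; apply: hK.
    by rewrite (bigD1 i)//= addnA addnAC leq_addl.
  rewrite sumr_const card_ord -[leLHS]mulr_natr -mulrA ler_piMr ?(ltW e0)//.
  by rewrite ler_pdivrMl// mulr1 ler_nat.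
(* The auxiliary index k depends on n but N does not, so the estimate survives the supremum over
   n. *)
have tail eps : 0 < eps -> exists N, forall m n, (N <= m)%N ->
    p n (fun i => u m i - a i) <= eps.
  move=> eps0; have [N hN] := cu eps eps0; exists N => m n Nm.
  apply/ler_addgt0Pr => e e0; have [k Nk hk] := small n e N e0.
  rewrite (_ : (fun i => _) = (fun i => (u m i - u k i) + (u k i - a i))); last first.
    by apply/funext => i; rewrite addrA subrK.
  apply: le_trans (sn_add hp _ _ _) _; apply: lerD => //.
  exact: le_trans (le_sup_norm _ (Esub m k)) (hN _ _ Nm Nk).
exists a; split.
  have [N hN] := tail 1 ltr01.
  apply: (sup_norm_bound (K := nrm (u N) + 1) _).1 => n.
  rewrite (_ : a = (fun i => u N i - (u N i - a i))); last first.
    by apply/funext => i; rewrite opprB addrC subrK.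
  apply: le_trans (solid_norms_sub _ _ _) _; apply: lerD; last exact: hN.
  exact: le_sup_norm.
move=> eps eps0; have [N hN] := tail eps eps0; exists N => n Nn.
by apply: (sup_norm_bound _).2 => m; apply: hN.
Qed.

Lemma sup_norm_banach_seq_lattice : banach_seq_lattice E nrm.
Proof.
have scale (c : R) a : E a -> E (fun i => c * a i) /\ nrm (fun i => c * a i) <= `|c| * nrm a.
  move=> Ea; apply: sup_norm_bound => n; apply: le_trans (solid_norms_scale _ _ _) _.
  by apply: ler_wpM2l => //; apply: le_sup_norm.
have add a b : E a -> E b -> E (fun i => a i + b i) /\ nrm (fun i => a i + b i) <= nrm a + nrm b.
  move=> Ea Eb; apply: sup_norm_bound => n; apply: le_trans (sn_add hp _ _ _) _.
  by apply: lerD; apply: le_sup_norm.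
have ge0 a : E a -> 0 <= nrm a.
  by move=> Ea; apply: le_trans (le_sup_norm 0 Ea); apply: (sn_ge0 hp).
split => //.
- apply: (sup_norm_bound (K := 0) _).1 => n; apply: le_trans (sn_l1 hp _ _) _.
  by rewrite big1 // => i _; rewrite normr0.
- by move=> a b Ea Eb; case: (add a b Ea Eb).
- by move=> c a Ea; case: (scale c a Ea).
- move=> a Ea na0; apply/funext => i; apply/eqP; rewrite -normr_le0 -na0.
  exact: le_trans (sn_ge hp a (ltnSn i)) (le_sup_norm _ Ea).
- move=> c a Ea; have [Eca ca] := scale c a Ea; apply/le_anti; rewrite ca /=.
  have [->|c0] := eqVneq c 0.
    by rewrite normr0 mul0r; apply: ge0; apply: (scale 0 a Ea).1.
  (* The reverse inequality is [scale] for the inverse of c, applied to c a. *)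
  have [_] := scale c^-1 _ Eca.
  rewrite (_ : (fun i => c^-1 * (c * a i)) = a); last first.
    by apply/funext => i; rewrite mulKf.
  by rewrite normfV ler_pdivlMl ?normr_gt0.
- by move=> a b Ea Eb; case: (add a b Ea Eb).
- exact: sup_norm_complete.
- move=> a b Ea ba; apply: sup_norm_bound => n; apply: le_trans (le_sup_norm n Ea).
  by apply: (sn_solid hp) => i _.
Qed.

(** * Rearrangement invariance *)

(* The indices are treated by decreasing [|b i|]: when [i] is reached, [{|a| > theta |b i|}]
   has at least as many elements as there are indices treated so far including [i].
   The factor [theta < 1] is needed since the [a i] need not tend to [0]. *)
Lemma rearrangement_injection (a b : nat -> R) (theta : R) n : 0 < theta < 1 ->
  (forall t : R, 0 < t -> ([set i | t < `|b i|] #<= [set i | t < `|a i|])%card) ->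
  exists t : nat -> nat, {in [pred i | (i < n)%N] &, injective t} /\
    forall i, (i < n)%N -> theta * `|b i| <= `|a (t i)|.
Proof.
move=> /andP[th0 th1] card_ab.
pose r i j := `|b j| <= `|b i|.
suff main s : uniq s -> pairwise r s -> exists t : nat -> nat,
    {in s &, injective t} /\ {in s, forall i, theta * `|b i| <= `|a (t i)|}.
  have rtot : total r by move=> i j; apply: le_total.
  have rtr : transitive r by move=> i j k ij jk; apply: le_trans jk ij.
  have us : uniq (sort r (iota 0 n)) by rewrite sort_uniq iota_uniq.
  have ps : pairwise r (sort r (iota 0 n)).
    by rewrite -(sorted_pairwise rtr); apply: sort_sorted.
  have [t [tinj ht]] := main _ us ps.
  have mem_s i : (i \in sort r (iota 0 n)) = (i < n)%N by rewrite mem_sort mem_iota.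
  exists t; split=> [i j|i] i_n; last by apply: ht; rewrite mem_s.
  by move=> jn; apply: tinj; rewrite mem_s.
elim/last_ind: s => [|s i IHs]; first by exists id.
rewrite rcons_uniq pairwise_rcons => /andP[i_s us] /andP[/allP bi sr].
have [t [tinj ht]] := IHs us sr.
suff [k kt hk] : exists2 k, k \notin [seq t j | j <- s] & theta * `|b i| <= `|a k|.
  have tE j : j \in s -> (if j == i then k else t j) = t j.
    by move=> js; case: eqP => // ji; rewrite -ji js in i_s.
  exists (fun j => if j == i then k else t j); split=> [j l|j]; last first.
    rewrite mem_rcons inE => /predU1P[->|js]; first by rewrite eqxx.
    by rewrite tE// ht.
  rewrite !mem_rcons !inE => /predU1P[->|js] /predU1P[->|ls] //; rewrite ?eqxx ?tE//.
  - by move=> kE; rewrite kE map_f in kt.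
  - by move=> kE; rewrite -kE map_f in kt.
  - exact: tinj.
have [bi0|bi0] := eqVneq (b i) 0.
  exists (\max_(j <- [seq t j | j <- s]) j).+1; last by rewrite bi0 normr0 mulr0.
  by apply/negP => kt; have := leq_bigmax_seq (P := xpredT) (F := id) _ kt isT; rewrite ltnn.
have pbi : 0 < `|b i| by rewrite normr_gt0.
have /card_ab/pcard_leP[f] : 0 < theta * `|b i| by rewrite mulr_gt0.
(* As theta < 1, the strict level set at theta |b i| contains i itself and all of [s]. *)
have bA j : j \in i :: s -> [set j | theta * `|b i| < `|b j|] j.
  move=> js /=; apply: (@lt_le_trans _ _ `|b i|); first by rewrite gtr_pMl.
  by move: js; rewrite inE => /predU1P[->//|/bi].
have uf : uniq [seq f j | j <- i :: s].
  rewrite map_inj_in_uniq /= ?i_s// => j l /bA Aj /bA Al.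
  by apply: 'inj_f; apply: mem_set.
(* Pigeonhole: [f] takes size s + 1 distinct values on i :: s, while [t] has used at most size s. *)
have : has (fun k => k \notin [seq t j | j <- s]) [seq f j | j <- i :: s].
  apply: contraT => /hasPn sub_ts.
  have := uniq_leq_size uf (fun k kf => negbNE (sub_ts k kf)).
  by rewrite !size_map ltnn.
move=> /hasP[k /mapP[j /bA/'funS_f fj ->] kt]; exists (f j) => //.
exact: ltW.
Qed.

(** The injection bounds theta [p n b] by [p n (a \o t)], hence by [p M a], for every theta < 1;
    then theta tends to 1. *)
Lemma sup_norm_rearrangement_invariant :
  (forall n M t a, inj_into n M t -> p n (a \o t) <= p M a) ->
  rearrangement_invariant E nrm.
Proof.
move=> reindex a b Ea card_ab; apply: sup_norm_bound => n.
have scaled theta : 0 < theta < 1 -> theta * p n b <= nrm a.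
  move=> th; have [t [tinj ht]] := rearrangement_injection n th card_ab.
  case/andP: th => th0 th1.
  pose M := (\max_(i < n) t i).+1.
  have tM : inj_into n M t.
    by split=> // i i_n; rewrite ltnS (leq_bigmax (F := t \o val) (Ordinal i_n)).
  apply: le_trans (le_sup_norm M Ea); apply: le_trans (reindex _ _ _ a tM).
  rewrite mulrC -ler_pdivlMr// mulrC.
  rewrite -[X in X * _]gtr0_norm ?invr_gt0//.
  apply: le_trans (sn_scale hp _ _ _); rewrite ?invr_eq0 ?gt_eqF//.
  apply: (sn_solid hp) => i i_n; rewrite normrM normfV (gtr0_norm th0).
  by rewrite mulrC ler_pdivlMr// mulrC ht.
rewrite leNgt; apply/negP => lt_ab.
have na0 : 0 <= nrm a by apply: le_trans (le_sup_norm 0 Ea); apply: (sn_ge0 hp).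
have pb0 : 0 < p n b by apply: le_lt_trans lt_ab.
(* This theta makes theta [p n b] the midpoint of [nrm a] and [p n b]. *)
have := scaled ((nrm a + p n b) / 2 / p n b).
rewrite divfK ?gt_eqF// ltr_pdivrMr// mul1r !divr_gt0 ?ltr_wpDl//= => h.
have : (nrm a + p n b) / 2 <= nrm a by apply: h; lra.
lra.
Qed.

End SolidNorms.

(** * Order arithmetic in a Banach lattice *)

Section VectorLattice.
Context (R : realType) (V : completeNormedModType R).
Context (le : V -> V -> Prop) (join : V -> V -> V).
Hypothesis BL : is_banach_lattice le join.

Lemma vle_refl x : le x x . Proof. exact: (bl_refl BL). Qed.
Lemma vle_trans y x z : le x y -> le y z -> le x z .
Proof. exact: (bl_trans BL). Qed.

#[local] Hint Resolve vle_refl : core.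

Definition vpos (x : V) : V := join x 0.

Lemma vle_addr z x y : le x y -> le (x + z) (y + z).
Proof. exact: (bl_add BL). Qed.

Lemma vle_add x y z t : le x y -> le z t -> le (x + z) (y + t).
Proof.
move=> xy zt; apply: vle_trans (vle_addr _ xy) _.
by rewrite ![y + _]addrC; apply: vle_addr.
Qed.

Lemma vle_subl_addr x y z : le (x - z) y <-> le x (y + z).
Proof.
split=> [/(vle_addr z)|/(vle_addr (- z))]; first by rewrite subrK.
by rewrite addrK.
Qed.

Lemma vle_subr_addr x y z : le x (y - z) <-> le (x + z) y.
Proof.
split=> [/(vle_addr z)|/(vle_addr (- z))]; first by rewrite subrK.
by rewrite addrK.
Qed.

Lemma vsub_ge0 x y : le 0 (y - x) <-> le x y.
Proof. by rewrite vle_subr_addr add0r. Qed.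

Lemma vle_opp x y : le x y -> le (- y) (- x).
Proof. by move=> xy; apply/vsub_ge0; rewrite opprK addrC; apply/vsub_ge0. Qed.

Lemma vle_oppl x y : le (- x) y -> le (- y) x.
Proof. by move=> /vle_opp; rewrite opprK. Qed.

Lemma vadd_ge0 x y : le 0 x -> le 0 y -> le 0 (x + y).
Proof. by move=> x0 y0; rewrite -[0]addr0; apply: vle_add. Qed.

Lemma vle_addl_ge0 x y : le 0 y -> le x (x + y).
Proof. by move=> y0; rewrite -[X in le X _]addr0; apply: vle_add. Qed.

Lemma vle_addr_ge0 x y : le 0 y -> le x (y + x).
Proof. by rewrite addrC; apply: vle_addl_ge0. Qed.

Lemma vscale_ge0 (a : R) x : 0 <= a -> le 0 x -> le 0 (a *: x).
Proof. by move=> a0 x0; rewrite -(scaler0 _ a); apply: (bl_scale BL). Qed.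

Lemma vscale_le (a b : R) x : a <= b -> le 0 x -> le (a *: x) (b *: x).
Proof.
by move=> ab x0; apply/vsub_ge0; rewrite -scalerBl; apply: vscale_ge0; rewrite ?subr_ge0.
Qed.

Lemma vscale_le_pos (a : R) x y : 0 < a -> le (a *: x) (a *: y) -> le x y.
Proof.
move=> a0 h; have := bl_scale BL (a := a^-1) _ h.
by rewrite !scalerA mulVf ?gt_eqF// !scale1r; apply; rewrite invr_ge0 ltW.
Qed.

Lemma vsum_ge0 (I : Type) (s : seq I) (P : pred I) (f : I -> V) :
  (forall i, P i -> le 0 (f i)) -> le 0 (\sum_(i <- s | P i) f i).
Proof. by move=> h; apply: (big_ind (le 0)) => //; exact: vadd_ge0. Qed.

Lemma vsum_le (I : Type) (s : seq I) (P : pred I) (f g : I -> V) :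
  (forall i, P i -> le (f i) (g i)) ->
  le (\sum_(i <- s | P i) f i) (\sum_(i <- s | P i) g i).
Proof. by move=> h; apply: (big_ind2 le) => // *; exact: vle_add. Qed.

Lemma vle_sum_term (I : finType) (P : pred I) (f : I -> V) i :
  (forall i, le 0 (f i)) -> P i -> le (f i) (\sum_(j | P j) f j).
Proof.
by move=> h Pi; rewrite (bigD1 i)//=; apply: vle_addl_ge0; apply: vsum_ge0.
Qed.

Lemma vle_join_l x y : le x (join x y). Proof. exact: (bl_join_l BL). Qed.
Lemma vle_join_r x y : le y (join x y). Proof. exact: (bl_join_r BL). Qed.
Lemma vjoin_le x y z : le x z -> le y z -> le (join x y) z.
Proof. exact: (bl_join_least BL). Qed.

Lemma vmeet_le_l x y : le (vmeet join x y) x.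
Proof. by apply: vle_oppl; apply: vle_join_l. Qed.
Lemma vmeet_le_r x y : le (vmeet join x y) y.
Proof. by apply: vle_oppl; apply: vle_join_r. Qed.
Lemma le_vmeet x y z : le z x -> le z y -> le z (vmeet join x y).
Proof.
by move=> zx zy; rewrite -[z]opprK; apply: vle_opp; apply: vjoin_le; apply: vle_opp.
Qed.

Lemma vpos_ge0 x : le 0 (vpos x). Proof. exact: vle_join_r. Qed.
Lemma le_vpos x : le x (vpos x). Proof. exact: vle_join_l. Qed.
Lemma vpos_le x y : le x y -> le 0 y -> le (vpos x) y.
Proof. exact: vjoin_le. Qed.
Lemma vpos_mono x y : le x y -> le (vpos x) (vpos y).
Proof.
by move=> xy; apply: vpos_le (vpos_ge0 _); apply: vle_trans xy (le_vpos _).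
Qed.

Lemma vpos_eq0_le x : vpos x = 0 -> le x 0.
Proof. by move=> <-; apply: le_vpos. Qed.

Lemma vposE x : vpos x = x + vpos (- x).
Proof.
apply: (bl_antisym BL).
  apply: vpos_le; first exact: vle_addl_ge0 (vpos_ge0 _).
  by rewrite addrC -{2}[x]opprK; apply/vsub_ge0/le_vpos.
rewrite addrC; apply/vle_subr_addr; apply: vpos_le; last exact/vsub_ge0/le_vpos.
exact: vle_addr_ge0 (vpos_ge0 _).
Qed.

Notation vabs := (vabs join).

Lemma le_vabs x : le x (vabs x). Proof. exact: vle_join_l. Qed.
Lemma leN_vabs x : le (- x) (vabs x). Proof. exact: vle_join_r. Qed.
Lemma vabs_le x y : le x y -> le (- x) y -> le (vabs x) y.
Proof. exact: vjoin_le. Qed.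

Lemma vabs_ge0 x : le 0 (vabs x).
Proof.
apply: (@vscale_le_pos 2) => //; rewrite scaler0 scaler_nat mulr2n -(subrr x).
by apply: vle_add (le_vabs x) (leN_vabs x).
Qed.

Lemma ger0_vabs x : le 0 x -> vabs x = x.
Proof.
move=> x0; apply: (bl_antisym BL) (le_vabs x); apply: vabs_le => //.
by apply: (vle_trans _ x0); rewrite -oppr0; apply: vle_opp.
Qed.

Lemma vabs_id x : vabs (vabs x) = vabs x.
Proof. by apply: ger0_vabs; apply: vabs_ge0. Qed.

Lemma vabsN x : vabs (- x) = vabs x.
Proof.
apply: (bl_antisym BL); apply: vabs_le; rewrite ?opprK ?le_vabs ?leN_vabs//.
  exact: leN_vabs.
exact: le_vabs.
by rewrite -{1}[x]opprK; exact: leN_vabs.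
exact: le_vabs.
Qed.

Lemma norm_vabs x : `|vabs x| = `|x|.
Proof. by apply/le_anti/andP; split; apply: (bl_norm BL); rewrite vabs_id. Qed.

Lemma vnorm_le x y : le 0 x -> le x y -> `|x| <= `|y|.
Proof.
move=> x0 xy; apply: (bl_norm BL); rewrite !ger0_vabs//.
exact: vle_trans x0 xy.
Qed.

Lemma vabsD x y : le (vabs (x + y)) (vabs x + vabs y).
Proof.
by apply: vabs_le; rewrite ?opprD; apply: vle_add; rewrite ?le_vabs ?leN_vabs//;
  do ?[exact: le_vabs|exact: leN_vabs].
Qed.

Lemma vabsZ_le (a : R) x : le (vabs (a *: x)) (`|a| *: vabs x).
Proof.
have pos (b : R) y : 0 <= b -> le (vabs (b *: y)) (b *: vabs y).
  move=> b0; apply: vabs_le; rewrite -?scalerN; apply: (bl_scale BL) => //.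
    exact: le_vabs.
  exact: leN_vabs.
case: (leP 0 a) => a0; first by rewrite ger0_norm//; apply: pos.
rewrite ltr0_norm// -[a *: x]opprK -scalerN -scaleNr -[vabs x]vabsN.
by apply: pos; rewrite oppr_ge0 ltW.
Qed.

Lemma vabsZ (a : R) x : vabs (a *: x) = `|a| *: vabs x.
Proof.
have [->|a0] := eqVneq a 0; first by rewrite !(normr0, scale0r) ger0_vabs.
apply: (bl_antisym BL); first exact: vabsZ_le.
apply: (@vscale_le_pos (`|a^-1|)); first by rewrite normr_gt0 invr_eq0.
rewrite scalerA -normrM mulVf// normr1 scale1r.
by rewrite -{1}[x]scale1r -(mulVf a0) -scalerA; exact: vabsZ_le.
Qed.

(** * Disjointness of positive elements *)

Definition pdisj (u v : V) :=
  [/\ le 0 u, le 0 v & forall w, le w u -> le w v -> le w 0].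

(** Passing from the meet to its universal property reduces each later disjointness proof to
    bounding a common lower bound. *)
Lemma vdisjointP x y : vdisjoint join x y <-> pdisj (vabs x) (vabs y).
Proof.
rewrite /vdisjoint; split=> [h|[x0 y0 h]].
  by split; try exact: vabs_ge0; move=> w wx wy; rewrite -h; apply: le_vmeet.
apply: (bl_antisym BL); last by apply: le_vmeet; exact: vabs_ge0.
by apply: h; [exact: vmeet_le_l|exact: vmeet_le_r].
Qed.

Lemma pdisjC u v : pdisj u v -> pdisj v u.
Proof. by case=> u0 v0 h; split=> // w wv wu; apply: h. Qed.

Lemma pdisj_mono u v u' v' : pdisj u v -> le 0 u' -> le u' u -> le 0 v' -> le v' v ->
  pdisj u' v'.
Proof.
move=> [u0 v0 h] u'0 uu v'0 vv; split=> // w wu wv.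
by apply: h; [exact: vle_trans wu uu|exact: vle_trans wv vv].
Qed.

(** If z lies below u + v and w, then z - v lies below u and w, so z lies below v as well as w. *)
Lemma pdisj_addl u v w : pdisj u w -> pdisj v w -> pdisj (u + v) w.
Proof.
move=> [u0 w0 h] [v0 _ h']; split=> //; first exact: vadd_ge0.
move=> z zuv zw; apply: h' => //.
have := h (z - v) ((vle_subl_addr _ _ _).2 zuv).
rewrite vle_subl_addr => /(_ (vle_trans zw (vle_addl_ge0 _ v0))).
by rewrite vle_subl_addr add0r.
Qed.

Lemma pdisj_suml (I : Type) (s : seq I) (P : pred I) (f : I -> V) w : le 0 w ->
  (forall i, P i -> pdisj (f i) w) -> pdisj (\sum_(i <- s | P i) f i) w.
Proof.
move=> w0 h; apply: (big_ind (fun x => pdisj x w)) => //.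
by move=> *; apply: pdisj_addl.
Qed.

Lemma pdisj_sumr (I : Type) (s : seq I) (P : pred I) (f : I -> V) w : le 0 w ->
  (forall i, P i -> pdisj w (f i)) -> pdisj w (\sum_(i <- s | P i) f i).
Proof. by move=> w0 h; apply/pdisjC/pdisj_suml => // i /h /pdisjC. Qed.

(** Divide by 1 + a, which dominates both a and 1: a common lower bound of a u and v becomes one of
    u and v. *)
Lemma pdisj_scalel (a : R) u v : 0 <= a -> pdisj u v -> pdisj (a *: u) v.
Proof.
move=> a0 [u0 v0 h]; split=> //; first exact: vscale_ge0.
move=> w wu wv; have b0 : 0 < 1 + a by rewrite ltr_pwDl.
have bi : 0 <= (1 + a)^-1 by rewrite invr_ge0 ltW.
suff : le ((1 + a)^-1 *: w) 0.
  by move=> /(bl_scale BL (ltW b0)); rewrite scaler0 scalerA divff ?gt_eqF// scale1r.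
have grow b y : le 0 y -> b <= 1 + a -> le (b *: y) ((1 + a) *: y).
  by move=> y0 b1; apply: vscale_le.
apply: h; apply: (@vscale_le_pos (1 + a)) => //;
  rewrite scalerA divff ?gt_eqF// scale1r.
  by apply: vle_trans wu _; apply: grow; rewrite ?lerDr.
by apply: vle_trans wv _; rewrite -[X in le X _]scale1r; apply: grow; rewrite ?lerDl.
Qed.

Lemma pdisj_scale (a b : R) u v : 0 <= a -> 0 <= b -> pdisj u v ->
  pdisj (a *: u) (b *: v).
Proof. by move=> a0 b0 h; apply/pdisj_scalel/pdisjC/pdisj_scalel/pdisjC. Qed.

(** A common lower bound w leaves x^- - w nonnegative and above -x, so minimality of x^- forces x^-
    <= x^- - w. *)
Lemma pdisj_vpos x : pdisj (vpos x) (vpos (- x)).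
Proof.
split; try exact: vpos_ge0.
move=> w w1 w2; suff : le (vpos (- x)) (vpos (- x) - w).
  by rewrite vle_subr_addr -{2}[vpos (- x)]add0r => /(vle_addr (- vpos (- x)));
    rewrite [_ + w]addrC !addrK.
apply: vpos_le; last by apply/vsub_ge0.
by apply/vle_subr_addr; rewrite addrC; apply/vle_subl_addr; rewrite addrC -vposE.
Qed.


Lemma pdisj_le_eq0 u v : pdisj u v -> le u v -> u = 0.
Proof.
move=> [u0 _ h] uv; apply: (bl_antisym BL) => //.
exact: h.
Qed.

(** The defect |x| + |y| - |x + y| lies below both 2|x| and 2|y|, which are disjoint. *)
Lemma vabs_add_disj x y : pdisj (vabs x) (vabs y) ->
  vabs (x + y) = vabs x + vabs y.
Proof.
move=> xy; apply: (bl_antisym BL); first exact: vabsD.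
have half u v : le (vabs u) (vabs (u + v) + vabs v).
  by rewrite -{1}[u](addrK v) -[vabs v]vabsN; apply: vabsD.
have two0 : (0 : R) <= 2 by [].
have [_ _ disj] := pdisj_scale two0 two0 xy.
rewrite -[X in le _ X]add0r; apply/vle_subl_addr/disj.
  rewrite scaler_nat mulr2n; apply/vle_subl_addr; rewrite -addrA.
  by apply: vle_add => //; rewrite addrC [x + y]addrC; apply: half.
rewrite scaler_nat mulr2n; apply/vle_subl_addr; rewrite -addrA addrC.
by apply: vle_add => //; rewrite addrC; apply: half.
Qed.

Lemma vabs_sum_disj (I : eqType) (s : seq I) (f : I -> V) : uniq s ->
  {in s &, forall i j, i != j -> pdisj (vabs (f i)) (vabs (f j))} ->
  vabs (\sum_(i <- s) f i) = \sum_(i <- s) vabs (f i).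
Proof.
elim: s => [|i s IHs] /=; first by rewrite !big_nil ger0_vabs.
move=> /andP[i_s us] disj; rewrite !big_cons -IHs //; last first.
  by move=> j k js ks; apply: disj; rewrite inE ?js ?ks orbT.
apply: vabs_add_disj; rewrite IHs//; last first.
  by move=> j k js ks; apply: disj; rewrite inE ?js ?ks orbT.
rewrite big_seq; apply: pdisj_sumr => [|j js]; first exact: vabs_ge0.
apply: disj; rewrite ?inE ?eqxx ?js ?orbT//.
by apply: contraNneq i_s => ->.
Qed.

(** * Combinations of disjoint vectors *)

Definition vdisj_upto (n : nat) (x : nat -> V) :=
  forall i j, (i < n)%N -> (j < n)%N -> i != j -> vdisjoint join (x i) (x j).

Lemma vabs_combo n a x : vdisj_upto n x ->
  vabs (combo n a x) = \sum_(i < n) `|a i| *: vabs (x i).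
Proof.
move=> dx; rewrite /combo vabs_sum_disj ?index_enum_uniq//.
  by apply: eq_bigr => i _; rewrite vabsZ.
move=> i j _ _ ij; rewrite !vabsZ; apply: pdisj_scale => //.
by apply/vdisjointP; apply: dx.
Qed.

Lemma norm_combo n a x : vdisj_upto n x ->
  `|combo n a x| = `|\sum_(i < n) `|a i| *: vabs (x i)|.
Proof. by move=> dx; rewrite -norm_vabs vabs_combo. Qed.

Lemma combo_solid n a b x : vdisj_upto n x ->
  (forall i, (i < n)%N -> `|b i| <= `|a i|) -> `|combo n b x| <= `|combo n a x|.
Proof.
move=> dx ba; rewrite !norm_combo//; apply: vnorm_le.
  by apply: vsum_ge0 => i _; apply: vscale_ge0 => //; apply: vabs_ge0.
by apply: vsum_le => i _; apply: vscale_le; [exact: ba|exact: vabs_ge0].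
Qed.

(** Setting the coefficients outside the image of [t] to zero turns the right combination into the
    left one, so solidity applies. *)
Lemma combo_reindex n M t a x : vdisj_upto M x -> inj_into n M t ->
  `|combo n (a \o t) (x \o t)| <= `|combo M a x|.
Proof.
move=> dx [tM tinj]; set s := [seq t i | i <- iota 0 n].
have us : uniq s.
  by rewrite map_inj_in_uniq ?iota_uniq// => i j; rewrite !mem_iota; apply: tinj.
have -> : combo n (a \o t) (x \o t) =
    combo M (fun j => if j \in s then a j else 0) x.
  rewrite /combo -(big_mkord xpredT (fun i => (a \o t) i *: (x \o t) i)).
  rewrite -(big_mkord xpredT (fun i => (if i \in s then a i else 0) *: x i)).
  transitivity (\sum_(j <- s) a j *: x j); first by rewrite big_map /index_iota subn0.
  transitivity (\sum_(0 <= j < M | j \in s) a j *: x j); last first.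
    by rewrite big_mkcond; apply: eq_bigr => i _; case: ifP => //; rewrite scale0r.
  rewrite -[RHS]big_filter; apply: perm_big; apply: uniq_perm => //.
    by rewrite filter_uniq ?iota_uniq.
  move=> j; rewrite mem_filter mem_index_iota /=.
  case: (boolP (j \in s)) => //= /mapP[i]; rewrite mem_iota add0n => /tM ? ->.
  by rewrite ?leq0n.
by apply: combo_solid => // i _; case: ifP => //; rewrite normr0.
Qed.

(** Terms are added one at a time: with S the sum so far, w i + S - x is a common lower bound of the
    disjoint elements w i and S. *)
Lemma disj_sum_le (I : finType) (w : I -> V) x : le 0 x ->
  (forall i j, i != j -> pdisj (w i) (w j)) -> (forall i, le 0 (w i)) ->
  (forall i, le (w i) x) -> le (\sum_i w i) x.
Proof.
move=> x0 dw w0 wx; elim: (index_enum I) (index_enum_uniq I) => [|i s IHs] /=.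
  by rewrite big_nil.
move=> /andP[i_s us]; rewrite big_cons; have {}IHs := IHs us.
rewrite -[x]add0r; apply/vle_subl_addr.
have [_ _ disj] : pdisj (w i) (\sum_(j <- s) w j).
  rewrite big_seq; apply: pdisj_sumr => // j js; apply: dw.
  by apply: contraNneq i_s => ->.
apply: disj; apply/vle_subl_addr; last by rewrite addrC; apply: vle_add.
by apply: vle_add.
Qed.

(** * Growth of disjoint sums when l_oo is not representable *)

Definition linf_growth (n : nat) (c : R) := forall w : nat -> V,
  (forall i, (i < n)%N -> le 0 (w i) /\ 1 <= `|w i|) ->
  (forall i j, (i < n)%N -> (j < n)%N -> i != j -> pdisj (w i) (w j)) ->
  c <= `|\sum_(i < n) w i|.

(** Disjoint positive vectors of norm at least 1 whose sum has norm below 1 + eps already span a (1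
    + eps)-copy of l_oo^n: each single term bounds the combination from below, m times the sum from
    above. *)
Lemma not_linf_flr_growth : ~ linf_flr join -> exists n c, 1 < c /\ linf_growth n c.
Proof.
move=> nflr; apply: contrapT => nex; apply: nflr => n eps eps0.
apply: contrapT => nx; apply: nex; exists n, (1 + eps); split.
  by rewrite ltrDl.
move=> w hw dw; rewrite leNgt; apply/negP => sw; apply: nx; exists w.
have dw' : vdisj_upto n w.
  move=> i j i_n jn ij; apply/vdisjointP; rewrite !ger0_vabs.
  - exact: dw.
  - exact: (hw _ jn).1.
  - exact: (hw _ i_n).1.
split=> // a; set m := \big[Num.max/0]_(i < n) _; cbv zeta.
have am i : (i < n)%N -> `|a i| <= m.
  by move=> i_n; rewrite /m (bigD1 (Ordinal i_n))//= le_max lexx.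
have wE : \sum_(i < n) vabs (w i) = \sum_(i < n) w i.
  by apply: eq_bigr => i _; rewrite ger0_vabs//; exact: (hw _ (ltn_ord i)).1.
split; last first.
  rewrite norm_combo//; apply: (@le_trans _ _ `|m *: \sum_(i < n) vabs (w i)|).
    apply: vnorm_le.
      by apply: vsum_ge0 => i _; apply: vscale_ge0 => //; apply: vabs_ge0.
    rewrite scaler_sumr; apply: vsum_le => i _; apply: vscale_le; first exact: am.
    exact: vabs_ge0.
  have m0 : 0 <= m by rewrite /m; elim/big_ind: _ => // x y x0 y0; rewrite le_max x0.
  by rewrite normrZ ger0_norm// mulrC wE ler_wpM2r// ltW.
apply: (big_ind (fun m => m <= _)) => // [x y|i _]; first by rewrite ge_max => -> ->.
rewrite norm_combo//; apply: (@le_trans _ _ `|(`|a i| *: w i)|).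
  by rewrite normrZ normr_id ler_peMr// (hw _ (ltn_ord i)).2.
have wi0 := (hw _ (ltn_ord i)).1.
apply: vnorm_le; first exact: vscale_ge0.
rewrite -{1}[w i]ger0_vabs//.
apply: (vle_sum_term (f := fun i : 'I_n => `|a i| *: vabs (w i))) => // j.
by apply: vscale_ge0 => //; apply: vabs_ge0.
Qed.

(* James's blocking argument: the sums over blocks are again disjoint and gain a factor [c]. *)
Lemma linf_growth_exp n c j : 0 < c -> linf_growth n c ->
  exists T : finType, forall (w : T -> V) (r : R), 0 < r ->
    (forall t, le 0 (w t)) -> (forall s t, s != t -> pdisj (w s) (w t)) ->
    (forall t, r <= `|w t|) -> c ^+ j * r <= `|\sum_t w t|.
Proof.
move=> c0 hc; elim: j => [|j [T IHT]].
  exists unit => w r r0 w0 _ wr.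
  by rewrite expr0 mul1r (big_pred1 tt) => [|[]//]; apply: wr.
exists ('I_n * T)%type => w r r0 w0 dw wr.
pose W (k : 'I_n) := \sum_t w (k, t).
have cr : 0 < c ^+ j * r by rewrite mulr_gt0// exprn_gt0.
(* Blocks rescaled to norm at least 1 and indexed by nat; the default 0 is met only from n on. *)
pose U (i : nat) := (c ^+ j * r)^-1 *: oapp W 0 (insub i).
have UE (k : 'I_n) : U k = (c ^+ j * r)^-1 *: W k by rewrite /U valK.
have W0 k : le 0 (W k) by apply: vsum_ge0.
have ->: \sum_t w t = \sum_k W k by rewrite pair_bigA; apply: eq_bigr => -[].
have -> : \sum_k W k = (c ^+ j * r) *: \sum_(k < n) U k.
  rewrite scaler_sumr; apply: eq_bigr => k _.
  by rewrite UE scalerA divff ?gt_eqF// scale1r.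
rewrite normrZ gtr0_norm// exprS -mulrA [c * _]mulrC ler_wpM2l ?(ltW cr)//.
have ci : 0 <= (c ^+ j * r)^-1 by rewrite invr_ge0 ltW.
apply: hc => [i i_n|i k i_n kn ik].
  rewrite -[i]/(nat_of_ord (Ordinal i_n)) UE; split; first exact: vscale_ge0.
  rewrite normrZ gtr0_norm ?invr_gt0// -(@ler_pM2l _ (c ^+ j * r))//.
  rewrite mulr1 mulrA divff ?gt_eqF// mul1r.
  apply: IHT => // s t st; apply: dw.
  by rewrite xpair_eqE eqxx.
rewrite -[i]/(nat_of_ord (Ordinal i_n)) -[k]/(nat_of_ord (Ordinal kn)) !UE.
apply: pdisj_scale => //; apply: pdisj_suml => // s _; apply: pdisj_sumr => // t _.
by apply: dw; rewrite xpair_eqE -val_eqE /= (negPf ik).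
Qed.

(** * Atoms, and long disjoint families in infinite dimension *)

Lemma arch_le0 (r K : R) : (forall eta : R, 0 < eta -> r <= eta * K) -> r <= 0.
Proof.
move=> h; rewrite leNgt; apply/negP => r0; have k0 : 0 < `|K| + 1 by rewrite ltr_wpDl.
set k := `|K| + 1 in k0; have q0 : 0 < r / k by rewrite divr_gt0.
have Kk : K <= k by rewrite (le_trans (ler_norm K))// lerDl.
have qk : r / k * k = r by rewrite divfK ?gt_eqF.
have := h (r / k / 2); rewrite divr_gt0// => /(_ isT).
have := ler_wpM2l (ltW q0) Kk; rewrite qk mulrAC => h1 h2; lra.
Qed.

(** The Archimedean property, read off the norm: 0 <= p <= eta e bounds the norm of p by eta times
    that of e. *)
Lemma vnorm_arch_eq0 (p e : V) : le 0 p ->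
  (forall eta : R, 0 < eta -> le p (eta *: e)) -> p = 0.
Proof.
move=> p0 h; apply/eqP; rewrite -normr_le0; apply: (@arch_le0 _ `|e|) => eta eta0.
rewrite -[eta in leRHS]gtr0_norm// -normrZ; apply: vnorm_le => //.
exact: h.
Qed.

(** This form of indecomposability is what maximality of a disjoint family yields directly. *)
Definition vatom (e : V) := forall u v, le 0 u -> le u e -> le 0 v -> le v e ->
  pdisj u v -> u = 0 \/ v = 0.

(** Take for c the largest t >= 0 with t e <= x. For y = x - c e and eta > 0, the positive and
    negative parts of y - eta e, cut down to e, are disjoint, so one of them vanishes; maximality of
    c decides which. *)
Lemma vatom_peel e x : le 0 e -> e != 0 -> vatom e -> le 0 x ->
  exists c : R, [/\ 0 <= c, le (c *: e) x & pdisj (x - c *: e) e].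
Proof.
move=> e0 en0 ate x0; have ne0 : 0 < `|e| by rewrite normr_gt0.
pose S : set R := [set t | 0 <= t /\ le (t *: e) x].
have S0 : S 0 by split => //; rewrite scale0r.
have ubS : ubound S (`|x| / `|e|).
  move=> t [t0 tx]; rewrite ler_pdivlMr// -[t]ger0_norm// -normrZ.
  by apply: vnorm_le => //; apply: vscale_ge0.
have hS : has_sup S by split; [exists 0|exists (`|x| / `|e|)].
have ubsup t : S t -> t <= sup S by apply: ub_le_sup; case: hS.
set c := sup S in ubsup *; have c0 : 0 <= c by apply: ubsup.
(* The supremum is attained: the positive part of c e - x lies below eta e for every eta > 0. *)
have cx : le (c *: e) x.
  rewrite -[x]add0r; apply/vle_subl_addr/vpos_eq0_le.
  apply: (@vnorm_arch_eq0 _ e) => [|eta eta0]; first exact: vpos_ge0.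
  apply: vpos_le; last exact: vscale_ge0 (ltW eta0) e0.
  have [t [t0 tx] ct] := sup_adherent eta0 hS.
  apply/vle_subl_addr/(vle_trans (y := eta *: e + t *: e)).
    by rewrite -scalerDl; apply: vscale_le => //; rewrite -lerBlDl ltW.
  exact: vle_add.
exists c; split => //; set y := x - c *: e.
have y0 : le 0 y by apply/vsub_ge0.
split=> // w wy we; suff -> : 0 = vpos w by apply: le_vpos.
apply/esym/(@vnorm_arch_eq0 _ e) => [|eta eta0]; first exact: vpos_ge0.
have eta_e : le 0 (eta *: e) by apply: vscale_ge0 => //; apply: ltW.
pose z := y - eta *: e.
pose u := vmeet join (vpos (- z)) e; pose v := vmeet join (vpos z) e.
have u0 : le 0 u by apply: le_vmeet => //; apply: vpos_ge0.
have v0 : le 0 v by apply: le_vmeet => //; apply: vpos_ge0.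
have ue : le u e by apply: vmeet_le_r.
have ve : le v e by apply: vmeet_le_r.
have vu : pdisj v u.
  by apply: (pdisj_mono (pdisj_vpos z)) => //; apply: vmeet_le_l.
have [vz|uz] := ate _ _ v0 ve u0 ue vu.
  (* Here (y - eta e)^+ is disjoint from e, which gives w^+ <= eta e. *)
  rewrite -[eta *: e]add0r; apply/vle_subl_addr.
  rewrite -vz; apply: le_vmeet.
    apply: vle_trans (le_vpos z); apply: vle_add => //; exact: vpos_le.
  apply/vle_subl_addr/vpos_le; last exact: vadd_ge0.
  exact: (vle_trans we (vle_addl_ge0 _ eta_e)).
(* Otherwise (y - eta e)^- vanishes, so c + eta would belong to [S]. *)
have dz : pdisj (vpos (- z)) e.
  split=> // [|q qz qe]; first exact: vpos_ge0.
  by rewrite -uz; apply: le_vmeet.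
have pz0 : vpos (- z) = 0.
  apply: (@pdisj_le_eq0 _ (eta *: e)).
    by apply/pdisjC/pdisj_scalel/pdisjC => //; apply: ltW.
  by apply: vpos_le => //; rewrite opprB; apply/vle_subl_addr/vle_addl_ge0.
have : S (c + eta).
  split; first by rewrite addr_ge0// ltW.
  rewrite scalerDl addrC; apply/vle_subr_addr/vsub_ge0.
  by have := vle_opp (vpos_eq0_le pz0); rewrite oppr0 opprK.
by move=> /ubsup; rewrite gerDl leNgt eta0.
Qed.

Definition has_disj (n : nat) (e : nat -> V) :=
  (forall i, (i < n)%N -> le 0 (e i) /\ e i != 0) /\
  (forall i j, (i < n)%N -> (j < n)%N -> i != j -> pdisj (e i) (e j)).

Lemma has_disjS n e y : has_disj n e -> le 0 y -> y != 0 ->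
  (forall i, (i < n)%N -> pdisj y (e i)) ->
  has_disj n.+1 (fun k => if k == n then y else e k).
Proof.
move=> [e0 de] y0 yn0 dy; split=> [i|i j].
  by rewrite ltnS leq_eqVlt; case: eqP => //= _; apply: e0.
rewrite (ltnS i) (ltnS j) (leq_eqVlt i) (leq_eqVlt j).
case: eqP => [->|_] /=; case: eqP => [->|_] //=.
- by rewrite eqxx.
- by move=> _ jn _; apply: dy.
- by move=> i_n _ _; apply/pdisjC/dy.
- exact: de.
Qed.

(* Maximality of [d] makes every [e i] an atom, so a positive [x] can be stripped of its
   component along each [e i]; what remains is disjoint from all of them, hence zero. *)
Lemma maximal_disj_span d e : has_disj d e ->
  (forall e', ~ has_disj d.+1 e') ->
  forall x, exists c : nat -> R, x = \sum_(i < d) c i *: e i.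
Proof.
move=> [e0 de] nd.
have maxi y : le 0 y -> (forall i, (i < d)%N -> pdisj y (e i)) -> y = 0.
  move=> y0 dy; apply/eqP/negP => /negP yn0.
  exact: (nd _ (has_disjS (conj e0 de) y0 yn0 dy)).
(* Nonzero disjoint u and v below [e i] would give d + 1 disjoint elements: u replaces [e i], and v
   is appended. *)
have atom i : (i < d)%N -> vatom (e i).
  move=> i_d u v u0 ue v0 ve uv.
  have [->|un0] := eqVneq u 0; [by left|right].
  apply/eqP/negP => /negP vn0.
  have hd : has_disj d (fun k => if k == i then u else e k).
    split=> [k kd|k l kd ld kl]; first by case: eqP => // _; apply: e0.
    case: eqP => [ki|_]; case: eqP => [li|_].
    - by rewrite ki li eqxx in kl.
    - apply: pdisj_mono (de i l i_d ld _) _ _ _ _ => //; first by rewrite -ki.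
      exact: (e0 l ld).1.
    - apply: pdisj_mono (de k i kd i_d _) _ _ _ _ => //; first by rewrite -li.
      exact: (e0 k kd).1.
    - exact: de.
  apply: (nd _ (has_disjS hd v0 vn0 _)) => k kd; case: eqP => [_|/eqP ki].
    exact/pdisjC.
  apply: pdisj_mono (de i k i_d kd _) _ _ _ _ => //; first by rewrite eq_sym.
  exact: (e0 k kd).1.
have pos_span x : le 0 x -> exists c : nat -> R, x = \sum_(i < d) c i *: e i.
  move=> x0; suff peel k : (k <= d)%N -> exists c : nat -> R,
      le 0 (x - \sum_(i < k) c i *: e i) /\
      forall i, (i < k)%N -> pdisj (x - \sum_(i < k) c i *: e i) (e i).
    have [c [y0 dy]] := peel d (leqnn d); exists c.
    by apply/eqP; rewrite -subr_eq0; apply/eqP/maxi.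
  elim: k => [_|k IHk kd]; first by exists (fun=> 0); rewrite big_ord0 subr0.
  have [c [y0 dy]] := IHk (ltnW kd).
  have [ek0 ekn0] := e0 k kd.
  have [t [t0 ty dt]] := vatom_peel ek0 ekn0 (atom k kd) y0.
  exists (fun i => if i == k then t else c i).
  rewrite big_ord_recr /= eqxx.
  rewrite (eq_bigr (fun i : 'I_k => c i *: e i)) => [|i _]; last by rewrite ltn_eqF.
  rewrite opprD addrA; set y := x - _ in y0 dy ty dt *.
  have yt0 : le 0 (y - t *: e k) by apply/vsub_ge0.
  split=> // i; rewrite ltnS leq_eqVlt => /predU1P[->//|ik].
  apply: pdisj_mono (dy i ik) yt0 _ _ _ => //.
    by apply/vle_subl_addr/vle_addl_ge0/vscale_ge0.
  exact: (e0 i (ltn_trans ik kd)).1.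
move=> x; have [c1 h1] := pos_span _ (vpos_ge0 x).
have [c2 h2] := pos_span _ (vpos_ge0 (- x)).
exists (fun i => c1 i - c2 i).
under eq_bigr do rewrite scalerBl.
by rewrite sumrB -h1 -h2 [vpos x]vposE addrK.
Qed.

(** The coefficients of d + 1 independent vectors over d generators form a matrix with nonzero left
    kernel, which yields a nontrivial linear relation. *)
Lemma infinite_dimensional_not_span d (e : nat -> V) : infinite_dimensional V ->
  ~ forall x, exists c : nat -> R, x = \sum_(i < d) c i *: e i.
Proof.
move=> /(_ d.+1)[v vfree] span.
have [C hC] := choice (fun j => span (v j)).
pose A : 'M[R]_(d.+1, d) := \matrix_(j, i) C j i.
have : kermx A != 0.
  rewrite -mxrank_eq0 mxrank_ker subn_eq0 -ltnNge ltnS.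
  exact: rank_leq_col.
move=> /rowV0Pn[r /sub_kermxP rA]; apply/negP/negPn/eqP/rowP => j; rewrite mxE.
apply: (vfree (r 0)).
under eq_bigr do rewrite hC scaler_sumr.
rewrite exchange_big big1 //= => i _.
under eq_bigr do rewrite scalerA.
rewrite -scaler_suml.
have := congr1 (fun B : 'rV_d => B 0 i) rA; rewrite !mxE.
by under eq_bigr do rewrite mxE; move=> ->; rewrite scale0r.
Qed.

(** If no family of n + 1 disjoint elements existed, a family of n would be maximal and would span
    V. *)
Lemma infinite_dimensional_has_disj n : infinite_dimensional V ->
  exists e, has_disj n e.
Proof.
move=> infd; elim: n => [|n [e en]]; first by exists (fun=> 0).
apply: contrapT => nn; apply: (infinite_dimensional_not_span infd (e := e)).
by apply: maximal_disj_span en _ => e' he'; apply: nn; exists e'.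
Qed.

Lemma norm_normalize (u : V) : u != 0 -> `| `|u|^-1 *: u| = 1.
Proof. by move=> u0; rewrite normrZ normfV normr_id mulVf// normr_eq0. Qed.

Lemma infinite_dimensional_disj_unit (I : finType) : infinite_dimensional V ->
  exists y : I -> V, [/\ forall i, le 0 (y i), forall i, `|y i| = 1 &
    forall i j, i != j -> pdisj (y i) (y j)].
Proof.
move=> infd; have [e [e0 de]] := infinite_dimensional_has_disj #|I| infd.
exists (fun i => `|e (enum_rank i)|^-1 *: e (enum_rank i)).
split=> [i|i|i j ij].
- by apply: vscale_ge0; rewrite ?invr_ge0//; apply: (e0 _ (ltn_ord _)).1.
- by apply: norm_normalize; apply: (e0 _ (ltn_ord _)).2.
- apply: pdisj_scale; rewrite ?invr_ge0//; apply: de => //.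
  by rewrite (inj_eq val_inj) (inj_eq enum_rank_inj).
Qed.

(** * Enlarging disjoint normalized tuples *)

Lemma expr_unbounded (c K : R) : 1 < c -> exists j, K < c ^+ j.
Proof.
move=> c1; have d0 : 0 < c - 1 by rewrite subr_gt0.
have bern j : 1 + j%:R * (c - 1) <= c ^+ j.
  elim: j => [|j IHj]; first by rewrite expr0 mul0r addr0.
  rewrite exprS; apply: le_trans (ler_wpM2l _ IHj); last by lra.
  rewrite -natr1; have : 0 <= j%:R * (c - 1) * (c - 1) by rewrite !mulr_ge0// ltW.
  set J := j%:R; lra.
have k0 : 0 <= `|K| / (c - 1) by rewrite divr_ge0// ltW.
exists (Num.bound (`|K| / (c - 1))); apply: lt_le_trans (bern _).
have := archi_boundP k0; rewrite ltr_pdivrMr// => h.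
by have := ler_norm K; lra.
Qed.

(** With Y the sum of all [y j], the first element is dominated by the positive part of X - lam Y
    and the second by its negative part. *)
Lemma pdisj_vpos_sub n M (x : nat -> V) (y : 'I_M -> V) (lam : R) :
  let X := \sum_(i < n) vabs (x i) in
  forall i k, (i < n)%N -> 0 <= lam -> (forall j, le 0 (y j)) ->
  pdisj (vpos (vabs (x i) - lam *: \sum_j y j)) (vpos (lam *: y k - X)).
Proof.
move=> X i k i_n lam0 y0; apply: pdisj_mono (pdisj_vpos (X - lam *: \sum_j y j)) _ _ _ _;
  try exact: vpos_ge0.
  apply: vpos_mono; apply: vle_add => //.
  apply: (vle_sum_term (f := fun i : 'I_n => vabs (x i)) (i := Ordinal i_n)) => // j.
  exact: vabs_ge0.
rewrite opprB; apply: vpos_mono; apply: vle_add => //; apply: (bl_scale BL) => //.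
exact: vle_sum_term.
Qed.

(** Each [x i], truncated and renormalized, moves to position [t i]; the free positions are filled
    with new vectors. *)
Lemma frakB_extend n M (t : nat -> nat) (a : nat -> R) (x : nat -> V) (eta : R) :
  infinite_dimensional V -> ~ linf_flr join ->
  inj_into n M t -> frakB join n x -> 0 < eta ->
  exists x', frakB join M x' /\ `|combo n (a \o t) x| <= `|combo M a x'| + eta.
Proof.
move=> infd nflr tM [xn dx] eta0.
have [n0 [c [c1 growth]]] := not_linf_flr_growth nflr.
have c0 : 0 < c by apply: lt_trans c1.
pose S := \sum_(i < n) `|a (t i)|.
have S0 : 0 <= S by apply: sumr_ge0.
have D0 : 0 < 1 + S + eta + eta by rewrite -!addrA ltr_pwDl// !addr_ge0// ltW.
(* Small enough for delta S <= eta, and below 1 so that no truncated [x i] vanishes. *)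
pose delta := eta / (1 + S + eta + eta).
have delta0 : 0 < delta by apply: divr_gt0.
have deltaS : delta * S <= eta.
  rewrite /delta mulrAC ler_pdivrMr// ler_wpM2l ?(ltW eta0)//; lra.
have delta1 : delta < 1 by rewrite ltr_pdivrMr// mul1r; lra.
(* The norm of X below is at most n; with this j, disjoint pieces of norm at least delta indexed by
   [T] would have a sum exceeding it. *)
have [j hj] : exists j, n%:R < c ^+ j * delta.
  have [j hj] := expr_unbounded (n%:R / delta) c1.
  by exists j; rewrite -ltr_pdivrMr.
have [T hT] := linf_growth_exp j c0 growth.
have [y [y0 y1 dy]] := infinite_dimensional_disj_unit (T * 'I_M)%type infd.
pose X := \sum_(i < n) vabs (x i).
have X0 : le 0 X by apply: vsum_ge0 => i _; apply: vabs_ge0.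
have Xn : `|X| <= n%:R.
  apply: (le_trans (ler_norm_sum _ _ _)).
  rewrite (eq_bigr (fun=> 1)) ?sumr_const ?card_ord// => i _.
  by rewrite norm_vabs xn.
(* [lam > |X|] rules out [lam *: y (s, k) <= X], so the [z k] below are nonzero. *)
pose lam : R := n%:R + 1.
have lam0 : 0 < lam by rewrite ltr_wpDl.
pose Y s := \sum_k y (s, k).
have Y0 s : le 0 (Y s) by apply: vsum_ge0.
have lamY0 s : le 0 (lam *: Y s) by apply: vscale_ge0 => //; apply: ltW.
(* The pieces [X /\ lam Y_s] are disjoint and dominated by [X], so they cannot all be
   large: some group of the [y (s, k)] lives essentially off the support of [x]. *)
have [s hs] : exists s, `|vmeet join X (lam *: Y s)| < delta.
  apply: contrapT => ns; have : c ^+ j * delta <= `|X|; last first.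
    by rewrite leNgt (le_lt_trans Xn).
  pose w s := vmeet join X (lam *: Y s).
  have w0 s : le 0 (w s) by apply: le_vmeet.
  have dw s1 s2 : s1 != s2 -> pdisj (w s1) (w s2).
    move=> s12; apply: (@pdisj_mono (lam *: Y s1) (lam *: Y s2)) => //;
      try exact: vmeet_le_r.
    apply: pdisj_scale; rewrite ?(ltW lam0)//.
    apply: pdisj_suml => // k _; apply: pdisj_sumr => // l _; apply: dy.
    by rewrite xpair_eqE (negPf s12).
  apply: (le_trans (hT w delta delta0 w0 dw _)).
    by move=> s; rewrite leNgt; apply/negP => ws; apply: ns; exists s.
  apply: vnorm_le; first exact: vsum_ge0.
  by apply: disj_sum_le => // s; apply: vmeet_le_l.
pose u i := vpos (vabs (x i) - lam *: Y s).
pose z k := vpos (lam *: y (s, k) - X).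
have u0 i : le 0 (u i) by apply: vpos_ge0.
have z0 k : le 0 (z k) by apply: vpos_ge0.
have ux i : le (u i) (vabs (x i)).
  apply: vpos_le; last exact: vabs_ge0.
  by apply/vle_subl_addr; apply: vle_addl_ge0.
have xu_ge0 i : le 0 (vabs (x i) - u i) by apply/vsub_ge0.
(* What truncation removes lies below both X and lam Y_s, hence below their small meet. *)
have xu i : (i < n)%N -> `|vabs (x i) - u i| <= delta.
  move=> i_n; apply: le_trans (ltW hs); apply: vnorm_le => //.
  apply: le_vmeet; apply/vle_subl_addr.
    apply: (vle_trans (y := X)); last exact: vle_addl_ge0.
    apply: (vle_sum_term (f := fun i : 'I_n => vabs (x i)) (i := Ordinal i_n)) => // k.
    exact: vabs_ge0.
  by rewrite addrC; apply/vle_subl_addr/le_vpos.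
have un0 i : (i < n)%N -> u i != 0.
  move=> i_n; apply: contraTneq delta1 => ui0.
  by have := xu _ i_n; rewrite ui0 subr0 norm_vabs xn// -leNgt.
have u1 i : (i < n)%N -> `|u i| <= 1.
  by move=> i_n; rewrite -(xn i i_n) -[`|x i|]norm_vabs; apply: vnorm_le.
have zn0 k : z k != 0.
  apply/negP => /eqP /vpos_eq0_le /vle_subl_addr; rewrite add0r => zX.
  have : lam <= n%:R.
    apply: le_trans Xn; rewrite -[lam]gtr0_norm// -[`|lam|]mulr1 -(y1 (s, k)) -normrZ.
    by apply: vnorm_le => //; apply: vscale_ge0 => //; apply: ltW.
  by rewrite /lam; lra.
have du i k : (i < n)%N -> (k < n)%N -> i != k -> pdisj (u i) (u k).
  by move=> i_n kn ik; apply: (pdisj_mono _ (u0 i) (ux i) (u0 k) (ux k));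
    apply/vdisjointP/dx.
have dz k l : k != l -> pdisj (z k) (z l).
  move=> kl; apply: (@pdisj_mono (lam *: y (s, k)) (lam *: y (s, l))) => //.
  - apply: pdisj_scale; rewrite ?(ltW lam0)//; apply: dy.
    by rewrite xpair_eqE eqxx.
  - by apply: vpos_le; [apply/vle_subl_addr/vle_addl_ge0|apply/vscale_ge0/y0/ltW].
  - by apply: vpos_le; [apply/vle_subl_addr/vle_addl_ge0|apply/vscale_ge0/y0/ltW].
have duz i k : (i < n)%N -> pdisj (u i) (z k).
  by move=> i_n; apply: pdisj_vpos_sub => //; apply: ltW.
pose tt := [seq t i | i <- iota 0 n].
have stt : size tt = n by rewrite size_map size_iota.
have idx m : m \in tt -> (index m tt < n)%N by rewrite -index_mem stt.
(* Position [t i] receives [u i], any other m < M receives [z m]; the default 0 occurs only for m >=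
   M. *)
pose g m := if m \in tt then u (index m tt) else oapp z 0 (insub m).
have g0 m : le 0 (g m) by rewrite /g; case: ifP => // _; case: insub => /=.
have gn0 m : (m < M)%N -> g m != 0.
  by rewrite /g => mM; case: ifP => [/idx/un0//|_]; rewrite insubT; apply: zn0.
have dg m l : (m < M)%N -> (l < M)%N -> m != l -> pdisj (g m) (g l).
  rewrite /g => mM lM ml; case: ifPn => mt; case: ifPn => lt.
  - apply: du; rewrite ?idx//; apply: contraNneq ml => h.
    by rewrite -(nth_index 0%N mt) h nth_index.
  - rewrite insubT; apply: duz.
    exact: idx.
  - by rewrite insubT; apply/pdisjC/duz/idx.
  - by rewrite !insubT; apply: dz.
have gt i : (i < n)%N -> g (t i) = u i.
  move=> i_n; have itt : t i \in tt by apply: map_f; rewrite mem_iota.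
  rewrite /g itt; congr u.
  apply: tM.2; rewrite ?inE ?idx//.
  have := nth_index 0%N itt; rewrite (nth_map 0%N) ?size_iota ?idx//.
  by rewrite nth_iota ?idx// add0n.
pose x' m := `|g m|^-1 *: g m.
have x'0 m : le 0 (x' m) by apply: vscale_ge0; rewrite ?invr_ge0.
have Bx' : frakB join M x'.
  split=> [m mM|m l mM lM ml]; first exact/norm_normalize/gn0.
  apply/vdisjointP; rewrite !ger0_vabs//.
  by apply: pdisj_scale; rewrite ?invr_ge0//; apply: dg.
exists x'; split=> //.
have [_ dx'] := Bx'.
have dxt : vdisj_upto n (x' \o t).
  move=> i k i_n kn ik; apply: dx'; try exact: tM.1.
  by apply: contraNneq ik => /tM.2 -> //; rewrite inE.
have := combo_reindex a dx' tM; rewrite norm_combo// => le_x'.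
rewrite norm_combo//; apply: le_trans (lerD le_x' deltaS).
(* The norm of [u i] is at most 1, so normalizing only enlarges the first sum; the second costs at
   most delta S. *)
rewrite (_ : \sum_(i < n) _ = \sum_(i < n) `|(a \o t) i| *: u i +
    \sum_(i < n) `|(a \o t) i| *: (vabs (x i) - u i)); last first.
  by rewrite -big_split; apply: eq_bigr => i _ /=; rewrite -scalerDr addrC subrK.
apply: le_trans (ler_normD _ _) _; apply: lerD.
  apply: vnorm_le; first by apply: vsum_ge0 => i _; apply: vscale_ge0.
  apply: vsum_le => i _; apply: (bl_scale BL) => //; rewrite ger0_vabs//= /x' gt//.
  rewrite -[X in le X _]scale1r; apply: vscale_le => //.
  by rewrite invf_ge1 ?u1// normr_gt0 un0.
apply: le_trans (ler_norm_sum _ _ _) _; rewrite mulr_sumr; apply: ler_sum => i _.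
by rewrite normrZ normr_id mulrC ler_wpM2r// xu.
Qed.

(** * The norms of X_U on R^n *)

Section FiniteNorms.
Hypothesis infd : infinite_dimensional V.

(** Over an empty set of tuples the supremum would be -oo and the infimum +oo; infinite dimension
    excludes this. *)
Lemma frakB_nonempty n : exists x, frakB join n x.
Proof.
have [e [e0 de]] := infinite_dimensional_has_disj n infd.
exists (fun i => `|e i|^-1 *: e i); split=> [i i_n|i j i_n jn ij].
  exact/norm_normalize/(e0 i i_n).2.
apply/vdisjointP; rewrite !vabsZ; apply: pdisj_scale => //.
by rewrite !ger0_vabs; [exact: de|exact: (e0 j jn).1|exact: (e0 i i_n).1].
Qed.

Lemma combo_ge n a x i : frakB join n x -> (i < n)%N -> `|a i| <= `|combo n a x|.
Proof.
move=> [xn dx] i_n; rewrite norm_combo//.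
rewrite (_ : `|a i| = `| `|a i| *: vabs (x i)|); last first.
  by rewrite normrZ normr_id norm_vabs xn// mulr1.
have t0 j : le 0 (`|a j| *: vabs (x j)) by apply: vscale_ge0 => //; apply: vabs_ge0.
apply: vnorm_le => //.
exact: (vle_sum_term (f := fun i : 'I_n => `|a i| *: vabs (x i)) (i := Ordinal i_n)).
Qed.

Lemma combo_l1 n a x : frakB join n x -> `|combo n a x| <= \sum_(i < n) `|a i|.
Proof.
move=> [xn _]; apply: le_trans (ler_norm_sum _ _ _) _; apply: ler_sum => i _.
by rewrite normrZ xn// mulr1.
Qed.

Lemma comboD n a b (x : nat -> V) :
  combo n (fun i => a i + b i) x = combo n a x + combo n b x.
Proof. by rewrite -big_split; apply: eq_bigr => i _; rewrite scalerDl. Qed.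

Lemma comboZ n c a (x : nat -> V) : combo n (fun i => c * a i) x = c *: combo n a x.
Proof. by rewrite scaler_sumr; apply: eq_bigr => i _; rewrite scalerA. Qed.

Definition norms_on n a : set R := [set `|combo n a x| | x in frakB join n].

Lemma norms_on_nonempty n a : norms_on n a !=set0.
Proof. by have [x Bx] := frakB_nonempty n; exists `|combo n a x|, x. Qed.

Lemma norms_on_ub n a : has_ubound (norms_on n a).
Proof. by exists (\sum_(i < n) `|a i|) => _ [x Bx <-]; apply: combo_l1. Qed.

Lemma norms_on_lb n a : has_lbound (norms_on n a).
Proof. by exists 0 => _ [x Bx <-]. Qed.

Definition rU n a : R := sup (norms_on n a).

Lemma normXUnE n a : normXUn join n a = (rU n a)%:E.
Proof.
rewrite -ereal_sup_EFin ?image_comp//; first exact: norms_on_ub.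
exact: norms_on_nonempty.
Qed.

Lemma le_rU n a x : frakB join n x -> `|combo n a x| <= rU n a.
Proof. by move=> Bx; apply: (ub_le_sup (norms_on_ub n a)); exists x. Qed.

Lemma rU_le n a c : (forall x, frakB join n x -> `|combo n a x| <= c) -> rU n a <= c.
Proof.
by move=> h; apply: (ge_sup (norms_on_nonempty n a)) => _ [x Bx <-]; apply: h.
Qed.

Lemma rU_solid_norms : solid_norms rU.
Proof.
split.
- move=> n a; have [x Bx] := frakB_nonempty n; exact: le_trans (normr_ge0 _) (le_rU a Bx).
- move=> n a i i_n; have [x Bx] := frakB_nonempty n.
  exact: le_trans (combo_ge a Bx i_n) (le_rU a Bx).
- by move=> n a; apply: rU_le => x Bx; apply: combo_l1.
- move=> n a b; apply: rU_le => x Bx; rewrite comboD.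
  by apply: le_trans (ler_normD _ _) _; apply: lerD; apply: le_rU.
- move=> n c a _; apply: rU_le => x Bx; rewrite comboZ normrZ.
  by apply: ler_wpM2l => //; apply: le_rU.
- move=> n a b ba; apply: rU_le => x Bx; apply: le_trans (le_rU a Bx).
  by apply: combo_solid => //; case: Bx.
Qed.

Lemma rU_reindex : ~ linf_flr join -> forall n M t a, inj_into n M t ->
  rU n (a \o t) <= rU M a.
Proof.
move=> nflr n M t a tM; apply: rU_le => x Bx; apply/ler_addgt0Pr => eta eta0.
have [x' [Bx' xx']] := frakB_extend a infd nflr tM Bx eta0.
by apply: le_trans xx' _; rewrite lerD2r; apply: le_rU.
Qed.

(** * The norms of X_L on R^n *)

Definition rPhi n a : R := inf (norms_on n a).

Lemma PhiE n a : Phi join n a = (rPhi n a)%:E.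
Proof.
rewrite -ereal_inf_EFin ?image_comp//; first exact: norms_on_lb.
exact: norms_on_nonempty.
Qed.

Lemma rPhi_le n a x : frakB join n x -> rPhi n a <= `|combo n a x|.
Proof. by move=> Bx; apply: (ge_inf (norms_on_lb n a)); exists x. Qed.

Lemma le_rPhi n a c : (forall x, frakB join n x -> c <= `|combo n a x|) -> c <= rPhi n a.
Proof.
by move=> h; apply: (lb_le_inf (norms_on_nonempty n a)) => _ [x Bx <-]; apply: h.
Qed.

Lemma rPhi_reindex n M t a : inj_into n M t -> rPhi n (a \o t) <= rPhi M a.
Proof.
move=> tM; apply: le_rPhi => x [xn dx].
apply: le_trans (combo_reindex a dx tM); apply: rPhi_le; split=> [i i_n|i j i_n jn ij].
  exact/xn/tM.1.
apply: dx; try exact: tM.1.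
by apply: contraNneq ij => /tM.2 -> //; rewrite inE.
Qed.

Lemma rPhi_mult n (c : R) (m : nat -> R) a : 0 < c ->
  (forall i, (i < n)%N -> `|m i| <= c) -> rPhi n (fun i => m i * a i) <= c * rPhi n a.
Proof.
move=> c0 mc; rewrite -ler_pdivrMl//; apply: le_rPhi => x Bx; rewrite ler_pdivrMl//.
apply: le_trans (rPhi_le _ Bx) _.
rewrite -[X in X * _](gtr0_norm c0) -normrZ -comboZ; apply: combo_solid; first by case: Bx.
by move=> i i_n; rewrite !normrM ler_wpM2r// (gtr0_norm c0) mc.
Qed.

Definition decomp n (a : nat -> R) (s : seq (nat -> R)) :=
  forall i, (i < n)%N -> a i = \sum_(b <- s) b i.

Definition decomp_costs n a : set R := [set \sum_(b <- s) rPhi n b | s in decomp n a].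

Lemma decomp1 n a : decomp n a [:: a].
Proof. by move=> i _; rewrite big_seq1. Qed.

Lemma decomp_costs_nonempty n a : decomp_costs n a !=set0.
Proof. by exists (\sum_(b <- [:: a]) rPhi n b), [:: a] => //; apply: decomp1. Qed.

Lemma rPhi_ge0 n a : 0 <= rPhi n a.
Proof. exact: le_rPhi. Qed.

Lemma decomp_costs_lb n a : has_lbound (decomp_costs n a).
Proof. by exists 0 => _ [s _ <-]; apply: sumr_ge0 => b _; apply: rPhi_ge0. Qed.

Definition rL n a : R := inf (decomp_costs n a).

Lemma normXLnE n a : normXLn join n a = (rL n a)%:E.
Proof.
rewrite -ereal_inf_EFin; [|exact: decomp_costs_lb|exact: decomp_costs_nonempty].
rewrite image_comp; congr ereal_inf; apply: eq_imagel => s _ /=.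
by rewrite -sumEFin; apply: eq_bigr => b _; rewrite PhiE.
Qed.

Lemma rL_le n a s : decomp n a s -> rL n a <= \sum_(b <- s) rPhi n b.
Proof. by move=> Ds; apply: (ge_inf (decomp_costs_lb n a)); exists s. Qed.

Lemma le_rL n a c : (forall s, decomp n a s -> c <= \sum_(b <- s) rPhi n b) -> c <= rL n a.
Proof.
by move=> h; apply: (lb_le_inf (decomp_costs_nonempty n a)) => _ [s Ds <-]; apply: h.
Qed.

(** A multiplier m acts termwise on decompositions. Constant m gives homogeneity of [rL], and m = b
    / a gives solidity. *)
Lemma rL_mult n (c : R) (m : nat -> R) a : 0 < c ->
  (forall i, (i < n)%N -> `|m i| <= c) -> rL n (fun i => m i * a i) <= c * rL n a.
Proof.
move=> c0 mc; rewrite -ler_pdivrMl//; apply: le_rL => s Ds; rewrite ler_pdivrMl//.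
have Dm : decomp n (fun i => m i * a i) [seq (fun i => m i * b i) | b <- s].
  by move=> i i_n; rewrite big_map (Ds i i_n) mulr_sumr.
apply: le_trans (rL_le Dm) _; rewrite big_map mulr_sumr; apply: ler_sum => b _.
exact: rPhi_mult.
Qed.

(** Composition with [t] carries decompositions of a to decompositions of [a \o t], at no greater
    cost by [rPhi_reindex]. *)
Lemma rL_reindex n M t a : inj_into n M t -> rL n (a \o t) <= rL M a.
Proof.
move=> tM; apply: le_rL => s Ds.
have Dt : decomp n (a \o t) [seq b \o t | b <- s].
  by move=> i i_n; rewrite big_map; apply: Ds; apply: tM.1.
apply: le_trans (rL_le Dt) _; rewrite big_map; apply: ler_sum => b _.
exact: rPhi_reindex.
Qed.

Lemma rL_solid_norms : solid_norms rL.
Proof.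
split.
- by move=> n a; apply: le_rL => s _; apply: sumr_ge0 => b _; apply: rPhi_ge0.
- move=> n a i i_n; apply: le_rL => s /(_ i i_n) ->.
  apply: le_trans (ler_norm_sum _ _ _) _; apply: ler_sum => b _.
  by apply: le_rPhi => x Bx; apply: combo_ge.
- move=> n a; apply: le_trans (rL_le (@decomp1 n a)) _; rewrite big_seq1.
  have [x Bx] := frakB_nonempty n.
  exact: le_trans (rPhi_le a Bx) (combo_l1 a Bx).
(* Concatenating decompositions of a and b gives one of the sum. *)
- move=> n a b; rewrite -lerBlDr; apply: le_rL => s1 D1.
  rewrite lerBlDr addrC -lerBlDr; apply: le_rL => s2 D2; rewrite lerBlDr addrC -big_cat.
  by apply: rL_le => i i_n; rewrite big_cat /= (D1 i i_n) (D2 i i_n).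
- by move=> n c a c0; apply: rL_mult; rewrite ?normr_gt0.
- move=> n a b ba; rewrite -[leRHS]mul1r.
  (* Division by zero gives 0, so the multiplier is bounded by 1 at the zeros of a too. *)
  apply: le_trans (rL_mult (m := fun i => b i / a i) (c := 1) _ _ _) => //; last first.
    move=> i i_n; rewrite normf_div; have [->|ai0] := eqVneq (a i) 0.
      by rewrite normr0 invr0 mulr0.
    by rewrite ler_pdivrMr ?normr_gt0// mul1r ba.
  (* The sequences b and (b / a) a are only known to agree below n, but decompositions see no other
     indices. *)
  apply: le_rL => s Ds; apply: rL_le => i i_n; rewrite -(Ds i i_n).
  have [ai0|ai0] := eqVneq (a i) 0; last by rewrite divfK.
  by have := ba i i_n; rewrite ai0 normr0 normr_le0 mulr0 => /eqP.
Qed.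

End FiniteNorms.

End VectorLattice.

Theorem mainTheorem4 (R : realType) (V : completeNormedModType R)
    (le : V -> V -> Prop) (join : V -> V -> V) :
  is_banach_lattice le join ->
  infinite_dimensional V ->
  ri_banach_seq_space (XL join) (nXL join) /\
  banach_seq_lattice (XU join) (nXU join) /\
  (~ linf_flr join -> rearrangement_invariant (XU join) (nXU join)).
Proof.
move=> BL infd.
have LE : normXL join = sup_norm (rL join).
  apply/funext => a; rewrite /normXL /sup_norm.
  by congr ereal_sup; apply: eq_imagel => n _; apply: (normXLnE BL infd).
have UE : normXU join = sup_norm (rU join).
  apply/funext => a; rewrite /normXU /sup_norm.
  by congr ereal_sup; apply: eq_imagel => n _; apply: (normXUnE BL infd).
have hL := rL_solid_norms BL infd.
have hU := rU_solid_norms BL infd.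
rewrite /XL /nXL /XU /nXU LE UE; split; [split|split].
- exact: sup_norm_banach_seq_lattice.
- exact/(sup_norm_rearrangement_invariant hL)/(rL_reindex BL infd).
- exact: sup_norm_banach_seq_lattice.
- by move=> nflr; apply/(sup_norm_rearrangement_invariant hU)/(rU_reindex BL infd nflr).
Qed.
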